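(* Let $n\ge 1$ and $N=2^n$. The minimum size of a training dataset of pure states that is sufficient for learning an $n$-qubit unitary is $t_{\min}=2^n$. That is: (i) there exist $N$ pure states (unit vectors) $|x_1\rangle,\dots,|x_N\rangle\in\mathbb{C}^N$ such that for every unitary $U$ on $\mathbb{C}^N$ the dataset $\{(|x_j\rangle\langle x_j|,\,U|x_j\rangle\langle x_j|U^\dagger)\}_{j=1}^N$ is sufficient for learning $U$; and (ii) for every $1\le t<N$, all pure states $|x_1\rangle,\dots,|x_t\rangle\in\mathbb{C}^N$ and every unitary $U$ on $\mathbb{C}^N$, the dataset $\{(|x_j\rangle\langle x_j|,\,U|x_j\rangle\langle x_j|U^\dagger)\}_{j=1}^t$ is not sufficient for learning $U$.
   Context: An $n$-qubit system has Hilbert space $\mathbb{C}^N$ with $N=2^n$. For unitaries $U,V$ on $\mathbb{C}^N$ the quantum risk is $$R_U(V)=1-\int |\langle\psi|U^\dagger V|\psi\rangle|^2\,d|\psi\rangle=1-\frac{N+|\operatorname{Tr}[U^\dagger V]|^2}{N(N+1)},$$ where the integral is over pure states with the uniform (Haar) probability measure. For density matrices $\rho_1,\dots,\rho_t$ and a target unitary $U$, the training dataset is $\{(\rho_j,U\rho_jU^\dagger)\}_{j=1}^t$. A unitary $V$ (the quantum machine learning model) is perfectly trained on this dataset if $V\rho_jV^\dagger=U\rho_jU^\dagger$ for all $j$ (zero empirical risk). The dataset is sufficient for learning $U$ if every perfectly trained unitary $V$ satisfies $R_U(V)=0$, and is not sufficient otherwise. *)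

(* Defs.v *)
From HB Require Import structures.
From mathcomp Require Import all_boot all_order all_algebra.
From mathcomp Require Import all_classical all_reals all_analysis.
From mathcomp Require Import complex.
Set Implicit Arguments.
Unset Strict Implicit.
Unset Printing Implicit Defensive.
Import Order.TTheory GRing.Theory Num.Theory numFieldNormedType.Exports.

Local Open Scope classical_set_scope.
Local Open Scope ring_scope.
Local Open Scope complex_scope.
Local Open Scope sesquilinear_scope.

(* [M ^t*] (the conjugate transpose) and [unitarymx] come from spectral.v;
   [unitarymx] asks M *m M ^t* = 1%:M, which for square M also gives
   M ^t* *m M = 1%:M. *)

Definition braket (R : realType) (N : nat) (x y : 'cV[R[i]]_N) : R[i] :=
  (x ^t* *m y) 0 0.

Definition unit_sphere (R : realType) (N : nat) : set 'cV[R[i]]_N :=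
  [set x | braket x x = 1].

Definition pure_density (R : realType) (N : nat) (x : 'cV[R[i]]_N) :
  'M[R[i]]_N := x *m x ^t*.

(* C^N with its Borel sigma-algebra. The regular module R[i]^o carries the
   topology of the modulus on R[i]. *)
Definition borel_space (R : realType) (N : nat) :=
  g_sigma_algebraType (@open 'cV[R[i]^o]_N).

(* The uniform (Haar) probability measure on pure states: the Borel probability
   measure carried by the unit sphere and invariant under the unitary group.
   For N >= 1 there is exactly one such measure. Global phases are not
   quotiented out: they do not affect the integrand of the risk. *)
Definition is_haar (R : realType) (N : nat)
    (mu : probability (borel_space R N) R) : Prop :=
  mu (@unit_sphere R N) = 1%E /\
  forall U : 'M[R[i]]_N, U \is unitarymx ->
  forall A : set (borel_space R N), measurable A ->
    mu ((fun x : 'cV[R[i]]_N => U *m x) @^-1` A) = mu A.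

(* [normc] is the modulus of a complex number as an element of R. *)
Definition risk (R : realType) (N : nat)
    (mu : probability (borel_space R N) R) (U V : 'M[R[i]]_N) : R :=
  1 - \int[mu]_(psi in @unit_sphere R N)
        (ComplexField.Normc.normc (braket psi (U ^t* *m V *m psi)) ^+ 2).

Definition dataset (R : realType) (N t : nat) : Type :=
  'I_t -> 'M[R[i]]_N * 'M[R[i]]_N.

Definition training_data (R : realType) (N t : nat) (U : 'M[R[i]]_N)
    (rho : 'I_t -> 'M[R[i]]_N) : dataset R N t :=
  fun j => (rho j, U *m rho j *m U ^t*).

Definition perfectly_trained (R : realType) (N t : nat) (V : 'M[R[i]]_N)
    (S : dataset R N t) : Prop :=
  forall j, V *m (S j).1 *m V ^t* = (S j).2.

Definition sufficient (R : realType) (N t : nat)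
    (mu : probability (borel_space R N) R) (U : 'M[R[i]]_N)
    (S : dataset R N t) : Prop :=
  forall V : 'M[R[i]]_N, V \is unitarymx -> perfectly_trained V S ->
    risk mu U V = 0.

(* Main.v *)
Require Import Defs.
From HB Require Import structures.
From mathcomp Require Import all_boot all_order all_algebra.
From mathcomp Require Import all_classical all_reals all_analysis.
From mathcomp Require Import measurable_realfun complex ring lra.
Set Implicit Arguments.
Unset Strict Implicit.
Unset Printing Implicit Defensive.
Import Order.TTheory GRing.Theory Num.Theory numFieldNormedType.Exports.
Local Open Scope classical_set_scope.
Local Open Scope ring_scope.
Local Open Scope complex_scope.
Local Open Scope sesquilinear_scope.

(* For (i), train on the normalised vectors e_0 and e_0 + e_j. If V is
   perfectly trained, W = U^dagger V commutes with all the corresponding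
   projections, which forces W to be a scalar of modulus 1, so the integrand of
   the risk is constantly 1 on the sphere.

   For (ii), pick y orthogonal to the t < N training vectors and let H be the
   reflection in the hyperplane orthogonal to y; then V = U H is perfectly
   trained. If its risk vanished, then |<psi|H psi>| = 1 for almost every psi,
   i.e. psi would be parallel or orthogonal to y. As any line can be moved to
   any other by a unitary, the invariance of the measure gives the same for
   every nonzero vector in place of y. But no unit vector is parallel or
   orthogonal to each of the vectors e_i and e_i + e_k (i <> k). *)

(** * The hermitian form on C^N *)

Lemma braketE (R : realType) N (x y : 'cV[R[i]]_N) :
  braket x y = \sum_i Num.conj (x i 0) * y i 0.
Proof. by rewrite /braket mxE; apply: eq_bigr => i _; rewrite !mxE. Qed.

Lemma braket_ge0 (R : realType) N (x : 'cV[R[i]]_N) : 0 <= braket x x.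
Proof. by rewrite braketE sumr_ge0// => i _; rewrite -normCKC exprn_ge0. Qed.

Lemma braket_eq0 (R : realType) N (x : 'cV[R[i]]_N) :
  (braket x x == 0) = (x == 0).
Proof.
apply/idP/eqP => [|->]; last first.
  by rewrite braketE big1// => i _; rewrite mxE mulr0.
rewrite braketE psumr_eq0 => [/allP x0|i _]; last by rewrite -normCKC exprn_ge0.
apply/colP => i; rewrite mxE; have := x0 i (mem_index_enum _).
by rewrite -normCKC expf_eq0 /= normr_eq0 => /eqP.
Qed.

Lemma conj_braket (R : realType) N (x y : 'cV[R[i]]_N) :
  Num.conj (braket x y) = braket y x.
Proof.
rewrite !braketE rmorph_sum; apply: eq_bigr => i _.
by rewrite rmorphM /= conjCK mulrC.
Qed.

Lemma adjmxM (C : numClosedFieldType) m n p (A : 'M[C]_(m, n))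
    (B : 'M[C]_(n, p)) :
  (A *m B) ^t* = B ^t* *m A ^t*.
Proof. by rewrite trmx_mul map_mxM. Qed.

Lemma braket_mull (R : realType) M N (A : 'M[R[i]]_(N, M)) x y :
  braket (A *m x) y = braket x (A ^t* *m y).
Proof. by rewrite /braket adjmxM mulmxA. Qed.

Lemma braketBr (R : realType) N (x y z : 'cV[R[i]]_N) :
  braket x (y - z) = braket x y - braket x z.
Proof. by rewrite /braket mulmxBr !mxE. Qed.

Lemma braketZr (R : realType) N a (x y : 'cV[R[i]]_N) :
  braket x (a *: y) = a * braket x y.
Proof. by rewrite /braket -scalemxAr mxE. Qed.

Lemma braketZl (R : realType) N a (x y : 'cV[R[i]]_N) :
  braket (a *: x) y = Num.conj a * braket x y.
Proof. by rewrite -conj_braket braketZr rmorphM /= conj_braket. Qed.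

Lemma adj_unitarymxM (C : numClosedFieldType) N (Q : 'M[C]_N) :
  Q \is unitarymx -> Q ^t* *m Q = 1%:M.
Proof. by move=> /unitarymxP /mulmx1C. Qed.

Lemma unit_sphere_unitary (R : realType) N (Q : 'M[R[i]]_N) x :
  Q \is unitarymx -> unit_sphere (Q *m x) = unit_sphere x.
Proof.
by move=> uQ; rewrite /unit_sphere/= braket_mull mulmxA adj_unitarymxM// mul1mx.
Qed.

(** * Householder reflections *)

Definition householder (R : realType) N (y : 'cV[R[i]]_N) : 'M[R[i]]_N :=
  1%:M - (2 / braket y y) *: (y *m y ^t*).

Lemma dyad_mul (R : realType) N (x y z : 'cV[R[i]]_N) :
  x *m y ^t* *m z = braket y z *: x.
Proof.
rewrite -mulmxA [_ *m z]mx11_scalar -/(braket y z).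
by apply/colP => i; rewrite !mxE big_ord1 !mxE mulr1n mulrC.
Qed.

Lemma householderE (R : realType) N (y x : 'cV[R[i]]_N) :
  householder y *m x = x - (2 / braket y y * braket y x) *: y.
Proof. by rewrite /householder mulmxBl mul1mx -scalemxAl dyad_mul scalerA. Qed.

Lemma householder_adj (R : realType) N (y : 'cV[R[i]]_N) :
  (householder y) ^t* = householder y.
Proof.
rewrite /householder linearB /= map_mxB trmx1 map_mx1 linearZ /= map_mxZ.
rewrite adjmxM trmxCK.
by congr (_ - _ *: _); rewrite rmorphM fmorphV /= conj_braket rmorph_nat.
Qed.

(** With P = y y^dagger and a = 2 / <y|y>, the identity P^2 = <y|y> P turns a^2 P^2 into 2 a P, so
    the hermitian matrix 1 - a P squares to 1. *)
Lemma householder_unitary (R : realType) N (y : 'cV[R[i]]_N) :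
  y != 0 -> householder y \is unitarymx.
Proof.
rewrite -braket_eq0 => y0; apply/unitarymxP; rewrite householder_adj /householder.
set a := 2 / _; set P := y *m _.
have PP : P *m P = braket y y *: P by rewrite mulmxA dyad_mul -scalemxAl.
have ab : a * (a * braket y y) = a + a by rewrite /a divfK// mulr_natr mulr2n.
rewrite mulmxBl mul1mx mulmxBr mulmx1 -scalemxAl -scalemxAr PP !scalerA -mulrA ab.
by rewrite scalerDl opprB addrK subrK.
Qed.

(** Conjugation by Q sends the dyad of y to that of Q y and keeps <y|y>, so it carries one
    reflection to the other. *)
Lemma householder_mul_unitary (R : realType) N (Q : 'M[R[i]]_N)
    (y : 'cV[R[i]]_N) :
  Q \is unitarymx -> householder (Q *m y) *m Q = Q *m householder y.
Proof.
move=> uQ; rewrite /householder braket_mull mulmxA adj_unitarymxM// mul1mx.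
rewrite mulmxBl mulmxBr mul1mx mulmx1 -scalemxAl -scalemxAr adjmxM.
rewrite -(mulmxA (Q *m y)) -(mulmxA (y ^t*)) (adj_unitarymxM uQ).
by rewrite mulmx1 mulmxA.
Qed.

(** Only the line of y matters: the factor |c|^2 from the dyad cancels against the one from
    <y|y>. *)
Lemma householderZ (R : realType) N c (y : 'cV[R[i]]_N) :
  c != 0 -> householder (c *: y) = householder y.
Proof.
move=> c0; rewrite /householder; congr (_ - _).
have -> : (c *: y) ^t* = Num.conj c *: y ^t*.
  by apply/matrixP => i j; rewrite !mxE rmorphM.
rewrite -scalemxAl -scalemxAr !scalerA braketZl braketZr.
(* Division by 0 yields 0, so in the degenerate case both coefficients vanish. *)
have [->|y0] := eqVneq (braket y y) 0.
  by rewrite !mulr0 invr0 mulr0 !mul0r.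
by congr (_ *: _); field; rewrite c0 y0 conjC_eq0 c0.
Qed.

(* For a unit vector x, the expectation r = <x|H x> of a hermitian unitary H
   satisfies 0 <= |x +- H x|^2 = 2 +- 2 r. *)
Lemma norm_braket_householder_le1 (R : realType) N (x y : 'cV[R[i]]_N) :
  y != 0 -> unit_sphere x -> `|braket x (householder y *m x)| <= 1.
Proof.
move=> y0 x1; set r := braket _ _.
have Hr : braket (householder y *m x) x = r by rewrite braket_mull householder_adj.
have rR : r \is Num.real by rewrite CrealE -[X in _ == X]Hr conj_braket.
have HH : braket (householder y *m x) (householder y *m x) = 1.
  by rewrite braket_mull mulmxA (adj_unitarymxM (householder_unitary y0)) mul1mx.
have e (s : R[i]) : s \is Num.real ->
    braket (householder y *m x - s *: x) (householder y *m x - s *: x) =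
    1 - 2 * s * r + s ^+ 2.
  move=> sR; rewrite braketBr braketZr -(conj_braket (householder y *m x)).
  rewrite -(conj_braket x) !braketBr !braketZr HH Hr x1 !rmorphB !rmorphM /=.
  rewrite (CrealP sR) (CrealP rR) rmorph1 -/r ; ring.
rewrite real_ler_norml//; apply/andP; split.
  have := braket_ge0 (householder y *m x - (-1) *: x).
  rewrite e ?rpredN ?rpred1 // => h.
  rewrite -subr_ge0 -(pmulr_rge0 _ (ltr0n R[i] 2)).
  by move: h; congr (_ <= _); ring.
have := braket_ge0 (householder y *m x - 1 *: x).
rewrite e ?rpred1 // => h.
rewrite -subr_ge0 -(pmulr_rge0 _ (ltr0n R[i] 2)).
by move: h; congr (_ <= _); ring.
Qed.

(** * Unitary completion, normalisation and orthogonal vectors *)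

Lemma unitary_col (R : realType) N (i0 : 'I_N) (y : 'cV[R[i]]_N) :
  i0 = 0%N :> nat -> y != 0 ->
  exists2 Q : 'M[R[i]]_N, Q \is unitarymx &
  exists2 c, c != 0 & y = c *: (Q *m delta_mx i0 0).
Proof.
(* Gram-Schmidt on N copies of y still returns a full orthonormal family. Row k of [A] lies in the
   span of rows 0 to k of [B]; at index 0 this is a single row, hence proportional to y. *)
move=> i00 y0; pose A := \matrix_(i < N) y^T; pose B := schmidt A.
exists B^T; first by rewrite trmx_unitary schmidt_unitarymx.
have /sub_rVP[c yB] : (y^T <= row i0 B)%MS.
  have := row_schmidt_sub A i0; rewrite rowK (big_pred1 i0) ?genmxE// => k.
  by rewrite /= -val_eqE /= i00 leqn0.
have yc : y = c *: (B^T *m delta_mx i0 0).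
  by apply: trmx_inj; rewrite yB linearZ /= -colE tr_col trmxK.
by exists c => //; apply: contra_neq y0 => c0; rewrite yc c0 scale0r.
Qed.

Lemma exists_normalization (R : realType) N (y : 'cV[R[i]]_N) :
  y != 0 -> exists2 c, c != 0 & unit_sphere (c *: y).
Proof.
rewrite -braket_eq0 => y0; have b0 := braket_ge0 y.
exists (sqrtC (braket y y))^-1; first by rewrite invr_eq0 sqrtC_eq0.
rewrite /unit_sphere /= braketZl braketZr mulrA -normCKC.
by rewrite normfV ger0_norm ?sqrtC_ge0// exprVn sqrtCK mulVf.
Qed.

(** Orthogonality is a system of t linear equations in N unknowns; its matrix has rank at most t <
    N, so the kernel is nonzero. *)
Lemma exists_orthogonal (R : realType) N t (x : 'I_t -> 'cV[R[i]]_N) :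
  (t < N)%N -> exists2 y, y != 0 & forall j, braket (x j) y = 0.
Proof.
move=> tN; pose M := \matrix_(k < N, j < t) Num.conj (x j k 0).
have /rowV0Pn[v vM v0] : kermx M != 0.
  by rewrite kermx_eq0 /row_free neq_ltn (leq_ltn_trans (rank_leq_col M)).
exists v^T => [|j]; first by rewrite -trmx0 (inj_eq trmx_inj).
have /matrixP/(_ 0 j) := sub_kermxP vM; rewrite !mxE => h.
by rewrite -[RHS]h braketE; apply: eq_bigr => k _; rewrite !mxE mulrC.
Qed.

(** * Measurability and integration *)

Lemma conj_continuous (K : numClosedFieldType) : continuous (Num.conj : K^o -> K^o).
Proof.
move=> x s /= /nbhs_ballP [e e0 es]; apply/nbhs_ballP; exists e => // y xy.
by apply: es; move: xy; rewrite /ball /= -rmorphB norm_conjC.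
Qed.

Lemma continuous_conj (K : numClosedFieldType) (T : topologicalType)
    (f : T -> K^o) :
  continuous f -> continuous (fun x => Num.conj (f x) : K^o).
Proof.
by move=> cf x; exact: (continuous_comp (cf x) (@conj_continuous K (f x))).
Qed.

Lemma continuous_sum (K : numFieldType) (T : topologicalType) (I : Type)
    (r : seq I) (f : I -> T -> K^o) :
  (forall i, continuous (f i)) -> continuous (fun x => \sum_(i <- r) f i x).
Proof.
move=> cf x; apply: cvg_big => [|i _]; [exact: add_continuous|exact: cf].
Qed.

Lemma quadratic_form_continuous (K : numClosedFieldType) N (W : 'M[K]_N) :
  continuous (fun x : 'cV[K^o]_N =>
    (((x : 'cV[K]_N) ^t* *m (W *m (x : 'cV[K]_N))) 0 0 : K^o)).
Proof.
set q := (F in continuous F).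
have -> : q = fun x : 'cV[K^o]_N =>
    \sum_i (Num.conj (x i 0) * \sum_j W i j * x j 0 : K^o).
  by apply/funext => y; rewrite /q mxE; apply: eq_bigr => i _; rewrite !mxE.
apply: continuous_sum => i.
have c1 : continuous (fun x : 'cV[K^o]_N => Num.conj (x i 0) : K^o).
  apply: continuous_conj; exact: (@coord_continuous K _ _ i 0).
have c2 : continuous (fun x : 'cV[K^o]_N => \sum_j W i j * x j 0 : K^o).
  apply: (@continuous_sum K 'cV[K^o]_N) => j.
  have c3 : continuous (fun x : 'cV[K^o]_N => x j 0 : K^o).
    exact: (@coord_continuous K _ _ j 0).
  by move=> x; exact: (continuousM (@cst_continuous _ K^o (W i j) _) (c3 x)).
by move=> x; exact: (continuousM (c1 x) (c2 x)).
Qed.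

Lemma Re_continuous (R : realType) : continuous (@complex.Re R : R[i]^o -> R).
Proof.
move=> x s /= /nbhs_ballP [e e0 es]; apply/nbhs_ballP; exists e%:C => /=.
  by rewrite ltcR.
move=> y xy; apply: es; move: xy; rewrite /ball /= => xy.
by rewrite -ltcR (le_lt_trans _ xy)// -raddfB/= normc_ge_Re.
Qed.

(** For W = U^dagger V this is the integrand of the risk. *)
Definition overlap (R : realType) N (W : 'M[R[i]]_N) (x : 'cV[R[i]]_N) : R :=
  ComplexField.Normc.normc (braket x (W *m x)) ^+ 2.

Lemma overlapE (R : realType) N (W : 'M[R[i]]_N) (x : 'cV[R[i]]_N) :
  (overlap W x)%:C = `|braket x (W *m x)| ^+ 2.
Proof. by rewrite rmorphXn. Qed.

Lemma continuous_measurable_borel_space (R : realType) N (f : 'cV[R[i]^o]_N -> R) :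
  continuous f -> measurable_fun setT (f : borel_space R N -> R).
Proof.
move=> /continuousP cf; apply: (measurability _ (RGenOpens.measurableE R)).
move=> _ [_ [a [b ->] <-]]; rewrite setTI; apply: sub_sigma_algebra.
exact/cf/interval_open.
Qed.

Lemma measurable_overlap (R : realType) N (W : 'M[R[i]]_N) :
  measurable_fun setT (overlap W : borel_space R N -> R).
Proof.
have cq : continuous (fun x : 'cV[R[i]^o]_N => braket x (W *m x) : R[i]^o).
  exact: (@quadratic_form_continuous R[i]).
have cn : continuous (fun x : 'cV[R[i]^o]_N =>
    Num.conj (braket x (W *m x)) * braket x (W *m x) : R[i]^o).
  have ccq := @continuous_conj R[i] _ _ cq.
  by move=> x; exact: (@continuousM R[i] _ _ _ x (ccq x) (cq x)).
apply: continuous_measurable_borel_space.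
(* The squared modulus is conj(q) q with q = <x|W x>; this product is real, so taking its real part
   loses nothing and gives a continuous map into [R]. *)
have -> : overlap W = fun x : 'cV[R[i]^o]_N =>
    complex.Re (Num.conj (braket x (W *m x)) * braket x (W *m x)).
  apply/funext => x; apply: (@complexI R).
  by rewrite overlapE normCKC RRe_real // -normCKC ger0_real ?exprn_ge0.
by move=> x; exact: (continuous_comp (cn x) (@Re_continuous R _)).
Qed.

Lemma measurable_unit_sphere (R : realType) N :
  measurable (@unit_sphere R N : set (borel_space R N)).
Proof.
(* For W = 1 the overlap is <x|x>^2, and <x|x> >= 0, so the value 1 singles out the sphere. *)
have -> : @unit_sphere R N = overlap 1%:M @^-1` [set 1].
  apply/seteqP; split => x; rewrite /unit_sphere /=; last first.
    move=> /(congr1 (real_complex R)) /eqP.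
    rewrite overlapE mul1mx ger0_norm ?braket_ge0// rmorph1.
    by rewrite sqrp_eq1 ?braket_ge0// => /eqP.
  by move=> h; apply: (@complexI R); rewrite overlapE mul1mx h normr1 expr1n.
rewrite -[X in measurable X]setTI; apply: measurable_overlap => //.
Qed.

(** The nonnegative function 1 - f has integral mu D - 1 = 0 over D, so it vanishes almost
    everywhere there. *)
Lemma ae_eq1_of_Rintegral d (T : measurableType d) (R : realType)
    (mu : {measure set T -> \bar R}) (D : set T) (f : T -> R) :
  measurable D -> mu D = 1%E -> measurable_fun setT f ->
  (forall x, D x -> 0 <= f x <= 1) -> \int[mu]_(x in D) f x = 1 ->
  {ae mu, forall x, D x -> f x = 1}.
Proof.
move=> mD D1 mf f01 int_f.
have mfD : measurable_fun D (fun x => (f x)%:E).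
  by apply/measurable_EFinP; exact: measurable_funTS.
have mgD : measurable_fun D (fun x => (1 - f x)%:E).
  apply/measurable_EFinP; apply: measurable_funTS.
  by apply: measurable_funB => //; exact: measurable_cst.
have int_fE : (\int[mu]_(x in D) (f x)%:E = 1)%E.
  (* The real integral sends infinite values to 0, so the value 1 forces the extended integral to be
     finite. *)
  move: int_f; rewrite /Rintegral; case: (integral _ _ _) => [r /= ->//| |] /= /esym/eqP;
    by rewrite oner_eq0.
have g0 x : D x -> (0 <= (1 - f x)%:E)%E.
  by move=> /f01 /andP[_ f1]; rewrite lee_fin subr_ge0.
have f0 x : D x -> (0 <= (f x)%:E)%E by move=> /f01 /andP[f0 _]; rewrite lee_fin.
have := ge0_integralD mu mD g0 mgD f0 mfD.
rewrite int_fE (eq_integral (cst 1%E)) => [|x _]; last first.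
  by rewrite -EFinD subrK.
rewrite integral_cst// D1 mule1 => e.
have int_g : (\int[mu]_(x in D) `|(1 - f x)%:E| = 0)%E.
  rewrite (eq_integral (fun x => (1 - f x)%:E)) => [|x /set_mem Dx]; last first.
    by rewrite gee0_abs// g0.
  by move: e; case: (integral _ _ _) => // r [] e; congr (_%:E); lra.
have := (ae_eq_integral_abs mu mD mgD).1 int_g.
apply: filterS => x /= h Dx; have [/eqP] := h Dx.
by rewrite subr_eq0 => /eqP.
Qed.

(** * Unit vectors neither parallel nor orthogonal to a given vector, and their measure *)

Definition overlap_neq1 (R : realType) N (y : 'cV[R[i]]_N) : set (borel_space R N) :=
  @unit_sphere R N `&` [set x | overlap (householder y) x != 1].

Lemma measurable_overlap_neq1 (R : realType) N (y : 'cV[R[i]]_N) : measurable (overlap_neq1 y).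
Proof.
apply: measurableI; first exact: measurable_unit_sphere.
have -> : [set x | overlap (householder y) x != 1] =
    ~` (overlap (householder y) @^-1` [set 1]).
  by apply/seteqP; split => x /= /eqP.
apply: measurableC; rewrite -[X in measurable X]setTI.
exact: measurable_overlap.
Qed.

Lemma overlap_neq1Z (R : realType) N c (y : 'cV[R[i]]_N) :
  c != 0 -> overlap_neq1 (c *: y) = overlap_neq1 y.
Proof. by move=> c0; rewrite /overlap_neq1 householderZ. Qed.

Lemma overlap_mul (R : realType) N (W Q : 'M[R[i]]_N) (x : 'cV[R[i]]_N) :
  overlap W (Q *m x) = overlap (Q ^t* *m W *m Q) x.
Proof. by rewrite /overlap [braket (Q *m x) _]braket_mull !mulmxA. Qed.

Lemma overlap_neq1_unitary (R : realType) N (Q : 'M[R[i]]_N) (y : 'cV[R[i]]_N) :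
  Q \is unitarymx -> mulmx Q @^-1` (overlap_neq1 (Q *m y)) = overlap_neq1 y.
Proof.
move=> uQ; have QHQ : Q ^t* *m householder (Q *m y) *m Q = householder y.
  by rewrite -mulmxA (householder_mul_unitary y uQ) mulmxA (adj_unitarymxM uQ) mul1mx.
apply/funext => x.
have e := etrans (overlap_mul _ Q x) (congr1 (fun W => overlap W x) QHQ).
(* Membership is a conjunction on each side: Q preserves the sphere, and the two overlaps agree. *)
exact (f_equal2 and (unit_sphere_unitary x uQ)
  (congr1 (fun r : R => is_true (r != 1)) e)).
Qed.

(** Some unitary moves the line of the first basis vector to the line of y, and the measure is
    invariant, so the value is the same for all nonzero y. *)
Lemma haar_overlap_neq1E (R : realType) N (mu : probability (borel_space R N) R)
    (i0 : 'I_N) (y : 'cV[R[i]]_N) :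
  is_haar mu -> i0 = 0%N :> nat -> y != 0 ->
  mu (overlap_neq1 y) = mu (overlap_neq1 (delta_mx i0 0)).
Proof.
move=> [_ inv] i00 y0; have [Q uQ [c c0 yE]] := unitary_col i00 y0.
rewrite yE (overlap_neq1Z _ c0) -(overlap_neq1_unitary (delta_mx i0 0) uQ).
by rewrite (inv Q uQ _ (measurable_overlap_neq1 _)).
Qed.

(** With p = |<y|x>|^2 and b = <y|y>, the expectation <x|H x> is the real number 1 - 2p/b. Its
    square is 1 only if p = 0 (x orthogonal to y) or p = b (equality in Cauchy-Schwarz, x parallel
    to y). *)
Lemma overlap_householder_eq1 (R : realType) N (x y : 'cV[R[i]]_N) :
  y != 0 -> unit_sphere x -> overlap (householder y) x = 1 ->
  (`|braket y x| ^+ 2 == 0) || (`|braket y x| ^+ 2 == braket y y).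
Proof.
rewrite -braket_eq0 => y0 x1 /(congr1 (real_complex R)).
rewrite overlapE rmorph1 householderE braketBr braketZr x1 -(mulrA (2 / _)).
rewrite -(conj_braket y x) -normCK.
set p := `|braket y x| ^+ 2; set b := braket y y.
have pR : 1 - 2 / b * p \is Num.real.
  by rewrite rpredB ?rpredM ?rpredV ?realn ?ger0_real ?braket_ge0 ?exprn_ge0.
rewrite (real_normK pR) => /eqP.
rewrite sqrf_eq1 => /orP[] /eqP h; apply/orP; [left|right].
  have : 2 / b * p = 0 by rewrite -(subKr 1 (2 / b * p)) h subrr.
  by move=> /eqP; rewrite !mulf_eq0 invr_eq0 (negbTE y0) pnatr_eq0.
apply/eqP; have -> : p = b / 2 * (1 - (1 - 2 / b * p)) by field; rewrite y0.
by rewrite h; field.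
Qed.

Lemma braket_delta (R : realType) N (i : 'I_N) (x : 'cV[R[i]]_N) :
  braket (delta_mx i 0) x = x i 0.
Proof.
rewrite braketE (bigD1 i)//= big1 => [|k /negbTE ki]; rewrite !mxE ?ki ?eqxx.
  by rewrite rmorph1 mul1r addr0.
by rewrite rmorph0 mul0r.
Qed.

Lemma braketDl (R : realType) N (x y z : 'cV[R[i]]_N) :
  braket (x + y) z = braket x z + braket y z.
Proof.
rewrite !braketE -big_split; apply: eq_bigr => i _.
by rewrite mxE rmorphD mulrDl.
Qed.

Lemma delta_cV_neq0 (R : realType) N (i : 'I_N) : delta_mx i 0 != 0 :> 'cV[R[i]]_N.
Proof. by rewrite -braket_eq0 braket_delta mxE !eqxx oner_eq0. Qed.

Lemma braket_delta2 (R : realType) N (i k : 'I_N) : i != k ->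
  braket (delta_mx i 0 + delta_mx k 0) (delta_mx i 0 + delta_mx k 0) = 2 :> R[i].
Proof.
move=> ik; rewrite braketDl !braket_delta !mxE !eqxx (negbTE ik) eq_sym (negbTE ik).
by rewrite /= addr0 add0r.
Qed.

(** Otherwise, testing against each e_i gives |x_i|^2 = 0 or 1, so exactly one coordinate x_i is
    nonzero. Then for any k other than i, |<e_i + e_k|x>|^2 = 1, which is neither 0 nor the squared
    norm 2 of e_i + e_k. *)
Lemma unit_sphere_overlap_neq1 (R : realType) N (x : 'cV[R[i]]_N) :
  (1 < N)%N -> unit_sphere x ->
  exists i, overlap_neq1 (delta_mx i 0) x \/
    exists2 k, i != k & overlap_neq1 (delta_mx i 0 + delta_mx k 0) x.
Proof.
move=> N1 x1; apply/not_existsP => Nneq1.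
have coord i : (`|x i 0| ^+ 2 == 0) || (`|x i 0| ^+ 2 == 1).
  have := @overlap_householder_eq1 R N x (delta_mx i 0) (delta_cV_neq0 R i) x1.
  rewrite !braket_delta [delta_mx _ _ _ _]mxE !eqxx; apply.
  by apply/eqP; apply: contrapT => /negP h; apply: (Nneq1 i); left.
have sqr_norm1 i : x i 0 != 0 -> `|x i 0| ^+ 2 = 1.
  move=> /negbTE xi0; have := coord i.
  by rewrite expf_eq0 /= normr_eq0 xi0 => /eqP.
(* The squared moduli sum to 1, so one coordinate of modulus 1 leaves nothing for the others. *)
have xi (i : 'I_N) : x i 0 != 0 -> forall k, k != i -> x k 0 = 0.
  move=> xi0 k ki.
  have xi1 := sqr_norm1 i xi0.
  have := x1; rewrite /unit_sphere /= braketE (bigD1 i)//= -normCKC xi1 -[RHS]addr0.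
  move=> /addrI /eqP; rewrite psumr_eq0 => [|j _]; last by rewrite -normCKC exprn_ge0.
  move=> /allP/(_ k (mem_index_enum _)) /=; rewrite ki /= -normCKC expf_eq0 /= normr_eq0.
  by move=> /eqP.
have [i xi0] : exists i, x i 0 != 0.
  apply/not_existsP => x0; have := x1; rewrite /unit_sphere /= braketE big1 => [/eqP|i _].
    by rewrite eq_sym oner_eq0.
  have /negP := x0 i; rewrite negbK => /eqP ->; exact: mulr0.
(* A second index exists because N > 1. *)
have [k ik] : exists k, i != k.
  apply/not_existsP => h; have : (#|'I_N| <= 1)%N.
    apply/card_le1P => a _ b.
    have ha c : i = c by apply/eqP; have /negP := h c; rewrite negbK.
    by rewrite [RHS]inE -(ha a) -(ha b) eqxx.
  by rewrite card_ord leqNgt N1.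
have y0 : delta_mx i 0 + delta_mx k 0 != 0 :> 'cV[R[i]]_N.
  by rewrite -braket_eq0 braket_delta2// pnatr_eq0.
have := overlap_householder_eq1 y0 x1.
rewrite braket_delta2// braketDl !braket_delta (xi i xi0 k); last by rewrite eq_sym.
rewrite addr0.
rewrite (sqr_norm1 i xi0) oner_eq0 (eqr_nat R[i] 1 2) => H.
have /H // : overlap (householder (delta_mx i 0 + delta_mx k 0)) x = 1.
by apply/eqP; apply: contrapT => /negP h; apply: (Nneq1 i); right; exists k.
Qed.

(** If the set were null for one y, it would be null for every nonzero vector. Finitely many such
    sets cover the sphere, which would then be null although it has mass 1. *)
Lemma haar_overlap_neq1_neq0 (R : realType) N (mu : probability (borel_space R N) R)
    (y : 'cV[R[i]]_N) :
  (1 < N)%N -> is_haar mu -> y != 0 -> mu (overlap_neq1 y) <> 0%E.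
Proof.
move=> N1 hmu y0 my0; pose i0 : 'I_N := Ordinal (ltnW N1).
have null z : z != 0 -> mu.-negligible (overlap_neq1 z).
  move=> z0; apply/(negligibleP _ (measurable_overlap_neq1 z)).
  have e w := @haar_overlap_neq1E R N mu i0 w hmu erefl.
  exact: (etrans (e z z0) (etrans (esym (e y y0)) my0)).
have : mu.-negligible (@unit_sphere R N : set (borel_space R N)).
  (* Indexing by pairs handles the vectors e_i and e_i + e_k in one finite intersection; on the
     diagonal the second condition is vacuous. *)
  have null2 (ik : 'I_N * 'I_N) : {ae mu, forall x, ~ overlap_neq1 (delta_mx ik.1 0) x /\
      (ik.1 != ik.2 -> ~ overlap_neq1 (delta_mx ik.1 0 + delta_mx ik.2 0) x)}.
    apply: filterI.
      by apply: negligibleS (null _ (delta_cV_neq0 R ik.1)) => x /= /contrapT.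
    have [e|ne] := eqVneq ik.1 ik.2; first by apply: aeW.
    have z0 : delta_mx ik.1 0 + delta_mx ik.2 0 != 0 :> 'cV[R[i]]_N.
      by rewrite -braket_eq0 braket_delta2// pnatr_eq0.
    apply: negligibleS (null _ z0) => x /= /not_implyP[_].
    exact: contrapT.
  have all_null := filter_forall (ae_filter_ringOfSetsType mu) null2.
  apply: (negligibleS _ (all_null : mu.-negligible _)) => x x1 /= h.
  have [i [b|[k ik b]]] := unit_sphere_overlap_neq1 N1 x1.
    by have [] := h (i, i).
  by have [_ /(_ ik)] := h (i, k).
move=> /(negligibleP _ (@measurable_unit_sphere R N)) mu0.
by have /eqP := etrans (esym hmu.1) mu0; rewrite onee_eq0.
Qed.

(** * Fewer than N states are not sufficient *)

Lemma pure_density_conj (R : realType) N (V : 'M[R[i]]_N) (x : 'cV[R[i]]_N) :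
  V *m pure_density x *m V ^t* = pure_density (V *m x).
Proof. by rewrite /pure_density adjmxM !mulmxA. Qed.

Lemma risk_mul (R : realType) N (mu : probability (borel_space R N) R)
    (U W : 'M[R[i]]_N) : U \is unitarymx ->
  risk mu U (U *m W) = 1 - \int[mu]_(x in @unit_sphere R N) overlap W x.
Proof. by move=> uU; rewrite /risk mulmxA (adj_unitarymxM uU) mul1mx. Qed.

Lemma overlap_householder_bound (R : realType) N (x y : 'cV[R[i]]_N) :
  y != 0 -> unit_sphere x -> 0 <= overlap (householder y) x <= 1.
Proof.
move=> y0 x1; rewrite exprn_even_ge0//= -lecR overlapE rmorph1.
by rewrite exprn_ile1// norm_braket_householder_le1.
Qed.

(** Zero risk means that the overlap, which lies between 0 and 1, integrates to 1. It is then 1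
    almost everywhere on the sphere, so [overlap_neq1 y] is null, which is excluded. *)
Lemma risk_householder_neq0 (R : realType) N (mu : probability (borel_space R N) R)
    (U : 'M[R[i]]_N) (y : 'cV[R[i]]_N) :
  (1 < N)%N -> is_haar mu -> U \is unitarymx -> y != 0 ->
  risk mu U (U *m householder y) <> 0.
Proof.
move=> N1 hmu uU y0; rewrite (risk_mul _ _ uU) => /subr0_eq /esym int1.
apply: (haar_overlap_neq1_neq0 N1 hmu y0).
apply/(negligibleP _ (measurable_overlap_neq1 y)).
have := ae_eq1_of_Rintegral (@measurable_unit_sphere R N) hmu.1
  (measurable_overlap (householder y)) (fun x => overlap_householder_bound y0) int1.
apply: negligibleS => x [x1 /eqP ne1] /= h; exact: ne1 (h x1).
Qed.

Lemma not_sufficient_lt (R : realType) N t (mu : probability (borel_space R N) R)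
    (x : 'I_t -> 'cV[R[i]]_N) (U : 'M[R[i]]_N) :
  (1 < N)%N -> is_haar mu -> (t < N)%N -> U \is unitarymx ->
  ~ sufficient mu U (training_data U (fun j => pure_density (x j))).
Proof.
move=> N1 hmu tN uU suff; have [y y0 xy] := exists_orthogonal x tN.
apply: (risk_householder_neq0 N1 hmu uU y0); apply: suff.
  by rewrite mul_unitarymx ?householder_unitary.
(* The reflection fixes each training vector, since <y|x_j> = 0. *)
move=> j; rewrite /= !pure_density_conj -mulmxA householderE.
by rewrite -(conj_braket (x j) y) xy rmorph0 mulr0 scale0r subr0.
Qed.

(** * A sufficient dataset of N states *)

(** The disjunction gives e_i0 + e_j for j different from i0 and e_i0 itself, not its double, for j
    = i0. *)
Definition anchored_vector (R : realType) N (i0 j : 'I_N) : 'cV[R[i]]_N :=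
  \col_i ((i == i0) || (i == j))%:R.

Lemma anchored_vector_neq0 (R : realType) N (i0 j : 'I_N) : anchored_vector R i0 j != 0.
Proof.
apply/eqP => /matrixP/(_ i0 0) /eqP; rewrite !mxE eqxx orTb.
by rewrite oner_eq0.
Qed.

(** Entries of W v v^dagger = v v^dagger W are compared. The vector for j = i0 kills row and column
    i0 off the diagonal. The vector for j = k then kills the other off-diagonal entries of column k
    and, at entry (i0, k), equates W_kk with W_i0i0. *)
Lemma commute_anchored_scalar (R : realType) N (i0 : 'I_N) (W : 'M[R[i]]_N) :
  (forall j, W *m pure_density (anchored_vector R i0 j) =
             pure_density (anchored_vector R i0 j) *m W) ->
  W = (W i0 i0)%:M.
Proof.
move=> comm.
(* The factor [(j != i0)%:R] avoids counting column i0 twice when j = i0. *)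
have Wv i j : (W *m anchored_vector R i0 j) i 0 = W i i0 + (j != i0)%:R * W i j.
  rewrite mxE (bigD1 i0)//= !mxE eqxx mulr1; congr (_ + _).
  have [->|ji] := eqVneq j i0.
    by rewrite mul0r big1// => k /negbTE ki; rewrite mxE ki mulr0.
  rewrite (bigD1 j)//= !mxE eqxx orbT mulr1 mul1r.
  rewrite big1 ?addr0// => k /andP[/negbTE k0 /negbTE kj].
  by rewrite mxE k0 kj mulr0.
have vW k j : ((anchored_vector R i0 j)^t* *m W) 0 k = W i0 k + (j != i0)%:R * W j k.
  rewrite mxE (bigD1 i0)//= !mxE eqxx rmorph1 mul1r; congr (_ + _).
  have [->|ji] := eqVneq j i0.
    by rewrite mul0r big1// => l /negbTE li; rewrite !mxE li rmorph0 mul0r.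
  rewrite (bigD1 j)//= !mxE eqxx orbT rmorph1 !mul1r.
  rewrite big1 ?addr0// => l /andP[/negbTE l0 /negbTE lj].
  by rewrite !mxE l0 lj rmorph0 mul0r.
have e i j k : (W i i0 + (j != i0)%:R * W i j) * ((k == i0) || (k == j))%:R =
    ((i == i0) || (i == j))%:R * (W i0 k + (j != i0)%:R * W j k).
  have /matrixP/(_ i k) := comm j; rewrite /pure_density mulmxA -[in RHS]mulmxA.
  by rewrite mxE big_ord1 Wv [in RHS]mxE big_ord1 vW !mxE rmorph_nat.
have W0 i : i != i0 -> W i i0 = 0.
  by move=> /negbTE ii; have := e i i0 i0; rewrite !eqxx ii !mul0r addr0 mulr1.
have W0' k : k != i0 -> W i0 k = 0.
  by move=> /negbTE ki; have := e i0 i0 k; rewrite !eqxx ki !mul0r !addr0 mulr0 mul1r => /esym.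
apply/matrixP => i k; rewrite !mxE.
have [->|ik] := eqVneq i k; last first.
  have [ii|ii] := eqVneq i i0; first by rewrite ii W0'// -ii eq_sym.
  have [->|ki] := eqVneq k i0; first exact: W0.
  have := e i k k; rewrite ki eqxx orbT (negbTE ii) (negbTE ik) mulr1 mul1r mul0r.
  by rewrite W0// add0r.
have [->//|ki] := eqVneq k i0.
have := e i0 k k; rewrite (W0' k ki) ki !eqxx orbT !mul1r mulr1.
by rewrite addr0 add0r.
Qed.

Lemma risk_scalar (R : realType) N (mu : probability (borel_space R N) R)
    (U : 'M[R[i]]_N) c : is_haar mu -> U \is unitarymx -> `|c| = 1 ->
  risk mu U (U *m c%:M) = 0.
Proof.
move=> hmu uU c1; rewrite (risk_mul _ _ uU).
rewrite (@eq_Rintegral _ _ _ mu _ (cst 1)) => [|x /set_mem x1].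
  rewrite (Rintegral_cst mu (@measurable_unit_sphere R N)) mul1r.
  by apply/eqP; rewrite subr_eq0; apply/eqP; exact: (esym (congr1 fine hmu.1)).
apply: (@complexI R); rewrite overlapE mul_scalar_mx braketZr x1.
by rewrite mulr1 c1 expr1n.
Qed.

(** Normalisation multiplies both sides by the same nonzero |c|^2, which cancels. Multiplying V rho
    V^dagger = U rho U^dagger by U^dagger on the left and V on the right gives the commutation. *)
Lemma perfectly_trained_comm (R : realType) N (U V : 'M[R[i]]_N) c
    (x : 'cV[R[i]]_N) :
  U \is unitarymx -> V \is unitarymx -> c != 0 ->
  V *m pure_density (c *: x) *m V ^t* = U *m pure_density (c *: x) *m U ^t* ->
  U ^t* *m V *m pure_density x = pure_density x *m (U ^t* *m V).
Proof.
move=> uU uV c0.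
have -> : pure_density (c *: x) = (c * Num.conj c) *: pure_density x.
  rewrite /pure_density -scalemxAl -scalerA; congr (_ *: _).
  by apply/matrixP => i j; rewrite !mxE !big_ord1 !mxE rmorphM mulrCA.
rewrite -!scalemxAr -!scalemxAl => /scalerI h.
have {}h : V *m pure_density x *m V ^t* = U *m pure_density x *m U ^t*.
  by apply: h; rewrite mulf_neq0 ?conjC_eq0.
have := congr1 (fun M => U ^t* *m M *m V) h.
rewrite !mulmxA (adj_unitarymxM uU) mul1mx -[LHS]mulmxA (adj_unitarymxM uV).
by rewrite mulmx1.
Qed.

Lemma exists_sufficient (R : realType) N (mu : probability (borel_space R N) R) :
  (0 < N)%N -> is_haar mu ->
  exists x : 'I_N -> 'cV[R[i]]_N, (forall j, unit_sphere (x j)) /\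
    forall U : 'M[R[i]]_N, U \is unitarymx ->
      sufficient mu U (training_data U (fun j => pure_density (x j))).
Proof.
move=> N0 hmu; pose i0 := Ordinal N0.
have /choice[c cP] : forall j, exists c : R[i],
    c != 0 /\ unit_sphere (c *: anchored_vector R i0 j).
  move=> j; have [c c0 c1] := exists_normalization (anchored_vector_neq0 R i0 j).
  by exists c.
exists (fun j => c j *: anchored_vector R i0 j); split=> [j|U uU V uV VP].
  by have [] := cP j.
pose W := U ^t* *m V.
have VE : V = U *m W by rewrite mulmxA (unitarymxP uU) mul1mx.
have WE : W = (W i0 i0)%:M.
  apply: commute_anchored_scalar => j.
  by apply: (perfectly_trained_comm uU uV (cP j).1); exact: VP j.
rewrite VE WE; apply: risk_scalar => //.
(* W is unitary, so the diagonal entry of W W^dagger = 1 says that the scalar has modulus 1. *)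
have /unitarymxP/matrixP/(_ i0 i0) : W \is unitarymx.
  by apply: mul_unitarymx => //; rewrite trmxC_unitary.
rewrite {1 2}WE tr_scalar_mx map_scalar_mx -scalar_mxM !mxE !eqxx !mulr1n.
rewrite -normCK => /eqP.
by rewrite sqrp_eq1 ?normr_ge0// => /eqP.
Qed.

Theorem mainTheorem1 (R : realType) (n : nat) (hn : (1 <= n)%N)
    (mu : probability (borel_space R (2 ^ n)%N) R) (hmu : is_haar mu) :
  (exists x : 'I_(2 ^ n)%N -> 'cV[R[i]]_(2 ^ n)%N,
     (forall j, unit_sphere (x j)) /\
     (forall U : 'M[R[i]]_(2 ^ n)%N, U \is unitarymx ->
        sufficient mu U (training_data U (fun j => pure_density (x j)))))
  /\
  (forall t : nat, (1 <= t)%N -> (t < 2 ^ n)%N ->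
   forall x : 'I_t -> 'cV[R[i]]_(2 ^ n)%N, (forall j, unit_sphere (x j)) ->
   forall U : 'M[R[i]]_(2 ^ n)%N, U \is unitarymx ->
     ~ sufficient mu U (training_data U (fun j => pure_density (x j)))).
Proof.
split; first by apply: exists_sufficient => //; rewrite expn_gt0.
move=> t _ tN x _ U uU; apply: not_sufficient_lt => //.
(* The dimension exceeds 1 because 2^0 < 2^n for n >= 1. *)
by rewrite -{1}(expn0 2) ltn_exp2l.
Qed.
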